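(* Let $\alpha,\beta\in\mathbb{R}$ with $\alpha\neq 0$, and let $(G_1,g,J)$ be the connected, simply connected three-dimensional Lorentzian Lie group with product structure $J$ whose Lie algebra $\mathfrak{g}$ has a pseudo-orthonormal basis $\{e_1,e_2,e_3\}$ ($e_3$ timelike) with $[e_1,e_2]=\alpha e_1-\beta e_3$, $[e_1,e_3]=-\alpha e_1-\beta e_2$, $[e_2,e_3]=\beta e_1+\alpha e_2+\alpha e_3$. Let $c\in\mathbb{R}$. Then $(G_1,g,J)$ is a second kind algebraic Ricci soliton associated to the canonical connection $\nabla^0$ with constant $c$ if and only if $\frac{\alpha^2}{2}+c=0$, $\beta=0$, $\alpha\neq 0$. In particular, in that case $\widetilde{\mathrm{Ric}}^0(e_1)=-\alpha^2e_1$, $\widetilde{\mathrm{Ric}}^0(e_2)=-\alpha^2e_2-\frac{\alpha^2}{2}e_3$, $\widetilde{\mathrm{Ric}}^0(e_3)=\frac{\alpha^2}{2}e_2$, and $De_1=-\frac{\alpha^2}{2}e_1$, $De_2=-\frac{\alpha^2}{2}e_2-\frac{\alpha^2}{2}e_3$, $De_3=\frac{\alpha^2}{2}e_2+\frac{\alpha^2}{2}e_3$.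
   Context: The left-invariant Lorentzian metric $g$ satisfies $g(e_1,e_1)=g(e_2,e_2)=1$, $g(e_3,e_3)=-1$, $g(e_i,e_j)=0$ for $i\ne j$. All tensors and connections are left-invariant and evaluated on $\mathfrak{g}$. $\nabla$ is the Levi-Civita connection of $g$. The product structure is $Je_1=e_1$, $Je_2=e_2$, $Je_3=-e_3$, and $(\nabla_XJ)Y=\nabla_X(JY)-J(\nabla_XY)$. The canonical connection is $\nabla^0_XY=\nabla_XY-\frac12(\nabla_XJ)(JY)$, with curvature $R^0(X,Y)Z=\nabla^0_X\nabla^0_YZ-\nabla^0_Y\nabla^0_XZ-\nabla^0_{[X,Y]}Z$. Its Ricci tensor is $\rho^0(X,Y)=-g(R^0(X,e_1)Y,e_1)-g(R^0(X,e_2)Y,e_2)+g(R^0(X,e_3)Y,e_3)$; its symmetrization is $\widetilde\rho^0(X,Y)=\frac12(\rho^0(X,Y)+\rho^0(Y,X))$, and the operator $\widetilde{\mathrm{Ric}}^0$ is defined by $\widetilde\rho^0(X,Y)=g(\widetilde{\mathrm{Ric}}^0(X),Y)$. Second kind algebraic Ricci soliton associated to $\nabla^0$ with constant $c$ means: $\widetilde{\mathrm{Ric}}^0=c\,\mathrm{Id}+D$ where $D$ is a derivation of $\mathfrak{g}$, i.e. a linear map with $D[X,Y]=[DX,Y]+[X,DY]$ for all $X,Y\in\mathfrak{g}$. *)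

(* Defs.v *)
From HB Require Import structures.
From mathcomp Require Import all_boot all_order all_algebra.
From mathcomp Require Import reals.

Set Implicit Arguments.
Unset Strict Implicit.
Unset Printing Implicit Defensive.

Import Order.TTheory GRing.Theory Num.Theory.
Local Open Scope ring_scope.

(* A left-invariant tensor on a Lie group G is determined by its value at the
   identity, i.e. by a tensor on the Lie algebra L of G; a left-invariant
   connection is likewise a bilinear map nabla : L -> L -> L, nabla X Y being
   the covariant derivative of the left-invariant field Y along X. Connected,
   simply connected Lie groups correspond to their finite-dimensional real Lie
   algebras, so the group is represented by L with its bracket. *)
Section LeftInvariantGeometry.
Variables (R : realType) (L : vectType R).

Definition lie_bracket (br : L -> L -> L) : Prop :=
  (forall X, br X X = 0) /\
  (forall X Y Z, br X (br Y Z) + br Y (br Z X) + br Z (br X Y) = 0).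

Definition derivation (br : L -> L -> L) (D : L -> L) : Prop :=
  forall X Y, D (br X Y) = br (D X) Y + br X (D Y).

Definition pseudo_orthonormal_basis (g : L -> L -> R) (e1 e2 e3 : L) : Prop :=
  basis_of fullv [:: e1; e2; e3] /\
  [/\ g e1 e1 = 1, g e2 e2 = 1 & g e3 e3 = -1] /\
  [/\ g e1 e2 = 0, g e1 e3 = 0 & g e2 e3 = 0].

(* In the metric condition the term X (g Y Z) is absent because g Y Z is a
   constant function on the group when g, Y and Z are left-invariant. *)
Definition levi_civita (br : L -> L -> L) (g : L -> L -> R)
    (nabla : L -> L -> L) : Prop :=
  (forall X Y, nabla X Y - nabla Y X = br X Y) /\
  (forall X Y Z, g (nabla X Y) Z + g Y (nabla X Z) = 0).

Definition cov_endo (nabla : L -> L -> L) (J : L -> L) (X Y : L) : L :=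
  nabla X (J Y) - J (nabla X Y).

Definition canonical_connection (nabla : L -> L -> L) (J : L -> L)
    (X Y : L) : L :=
  nabla X Y - 2^-1 *: cov_endo nabla J X (J Y).

Definition curvature (br nabla : L -> L -> L) (X Y Z : L) : L :=
  nabla X (nabla Y Z) - nabla Y (nabla X Z) - nabla (br X Y) Z.

Definition ricci (br : L -> L -> L) (g : L -> L -> R) (e1 e2 e3 : L)
    (nabla : L -> L -> L) (X Y : L) : R :=
  - g (curvature br nabla X e1 Y) e1
  - g (curvature br nabla X e2 Y) e2
  + g (curvature br nabla X e3 Y) e3.

Definition ricci_sym (br : L -> L -> L) (g : L -> L -> R) (e1 e2 e3 : L)
    (nabla : L -> L -> L) (X Y : L) : R :=
  2^-1 * (ricci br g e1 e2 e3 nabla X Y + ricci br g e1 e2 e3 nabla Y X).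

(* For nondegenerate g this determines Ric. *)
Definition sym_ricci_operator (br : L -> L -> L) (g : L -> L -> R)
    (e1 e2 e3 : L) (nabla : L -> L -> L) (Ric : L -> L) : Prop :=
  forall X Y, ricci_sym br g e1 e2 e3 nabla X Y = g (Ric X) Y.

Definition soliton_data (br : L -> L -> L) (g : L -> L -> R) (e1 e2 e3 : L)
    (nabla : L -> L -> L) (c : R) (Ric D : L -> L) : Prop :=
  [/\ sym_ricci_operator br g e1 e2 e3 nabla Ric,
      derivation br D
    & forall X, Ric X = c *: X + D X].

Definition second_kind_soliton (br : L -> L -> L) (g : L -> L -> R)
    (e1 e2 e3 : L) (nabla : L -> L -> L) (c : R) : Prop :=
  exists Ric D : 'End(L), soliton_data br g e1 e2 e3 nabla c Ric D.

End LeftInvariantGeometry.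

(* Main.v *)
(** The canonical connection preserves both eigenspaces of [J] and is metric,
    so it kills [e3] and acts on the plane of [e1], [e2] by
    [nabla0_X e1 = w(X) e2], [nabla0_X e2 = - w(X) e1] with
    [w(X) = g (nabla_X e1) e2].  Rotations of a plane commute, hence [R0(X, Y)]
    is the rotation with coefficient [- w([X, Y])], and the Koszul formula gives
    [w = (- alpha, 0, beta / 2)] on the frame.  With [D = Ric - c Id], the
    [e2]-component of [D [e1, e2] = [D e1, e2] + [e1, D e2]] reads
    [alpha^2 beta = 0] up to a nonzero factor, and for [beta = 0] its
    [e1]-component is [alpha (alpha^2 / 2 + c) = 0]. *)
Require Import Defs.
From HB Require Import structures.
From mathcomp Require Import all_boot all_order all_algebra.
From mathcomp Require Import reals.
From mathcomp Require Import ring lra.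
Set Implicit Arguments.
Unset Strict Implicit.
Unset Printing Implicit Defensive.
Import Order.TTheory GRing.Theory Num.Theory.
Local Open Scope ring_scope.

(** * Coordinates in a pseudo-orthonormal frame *)

Section PseudoOrthonormalFrame.
Variables (R : realType) (L : vectType R) (g : {symmetric L}).
Variables e1 e2 e3 : L.
Hypothesis e_frame : pseudo_orthonormal_basis g e1 e2 e3.

Let gC X Y : g X Y = g Y X.
Proof. by rewrite hermC expr0 mul1r. Qed.

Lemma g_frame :
  ((g e1 e1 = 1) * (g e2 e2 = 1) * (g e3 e3 = -1)) *
  ((g e1 e2 = 0) * (g e1 e3 = 0) * (g e2 e3 = 0)) *
  ((g e2 e1 = 0) * (g e3 e1 = 0) * (g e3 e2 = 0)).
Proof.
case: e_frame => _ [[-> -> ->] [g12 g13 g23]].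
by rewrite g12 g13 g23 gC g12 gC g13 gC g23.
Qed.

Lemma form_linl : (forall X Y Z, g (X + Y) Z = g X Z + g Y Z) *
  (forall X Y Z, g (X - Y) Z = g X Z - g Y Z) *
  (forall X Z, g (- X) Z = - g X Z) * (forall Z, g 0 Z = 0) *
  (forall a X Z, g (a *: X) Z = a * g X Z).
Proof.
split=> [|a X Z]; last by rewrite linearZl_LR.
split=> [|Z]; last by rewrite linear0l.
split=> [|X Z]; last by rewrite linearNl.
by split=> X Y Z; [rewrite linearDl | rewrite linearBl].
Qed.

Definition gE := (form_linl, g_frame).

(** The minus sign comes from [g e3 e3 = -1]: the [e3]-coordinate of [X] is [- g X e3]. *)
Lemma frame_expansion X : X = g X e1 *: e1 + g X e2 *: e2 - g X e3 *: e3.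
Proof.
case: e_frame => /andP[/eqP span_e _] _.
have : X \in <<[tuple e1; e2; e3]>>%VS by rewrite /= span_e memvf.
move=> /coord_span; rewrite !big_ord_recl big_ord0 addr0 /= addrA.
set a := coord _ _ _; set b := coord _ _ _; set d := coord _ _ _ => ->.
by rewrite !gE !(mulr0, mulr1, addr0, add0r) mulrN1 scaleNr opprK.
Qed.

(** Nondegeneracy of [g]; it reduces vector identities to three scalar ones, within reach of [ring]
    and [field]. *)
Lemma frame_eq X Y :
  g X e1 = g Y e1 -> g X e2 = g Y e2 -> g X e3 = g Y e3 -> X = Y.
Proof.
by move=> E1 E2 E3; rewrite (frame_expansion X) E1 E2 E3 -frame_expansion.
Qed.

(** The linear map sending each [ei] to [vi]; it serves to build the witnesses [Ric] and [D]. *)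
Definition frame_map (v1 v2 v3 X : L) : L :=
  g X e1 *: v1 + g X e2 *: v2 - g X e3 *: v3.

Fact frame_map_is_linear v1 v2 v3 : linear (frame_map v1 v2 v3).
Proof.
move=> a X Y; rewrite /frame_map !form_linl.
rewrite !scalerDl -!scalerA scalerBr scalerDr opprD !addrA.
by rewrite [LHS](ACl (1*3*5*2*4*6)%AC) /= ?addrA.
Qed.

HB.instance Definition _ v1 v2 v3 :=
  GRing.isLinear.Build R L L _ (frame_map v1 v2 v3)
    (frame_map_is_linear v1 v2 v3).

(** * The canonical connection, its curvature and its Ricci form *)

Variables (nabla : {bilinear L -> L -> L}) (J : 'End(L)).
Hypothesis nabla_metric : forall X Y Z, g (nabla X Y) Z + g Y (nabla X Z) = 0.
Hypothesis J_frame : [/\ J e1 = e1, J e2 = e2 & J e3 = - e3].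

Lemma product_structureE X : J X = g X e1 *: e1 + g X e2 *: e2 + g X e3 *: e3.
Proof.
case: J_frame => J1 J2 J3.
by rewrite {1}(frame_expansion X) linearB linearD !linearZ /= J1 J2 J3 opprK.
Qed.

Lemma bilinear_frame (f : {bilinear L -> L -> L}) X Y :
  f X Y = g Y e1 *: f X e1 + g Y e2 *: f X e2 - g Y e3 *: f X e3.
Proof.
by rewrite {1}(frame_expansion Y) linearBr linearDr !linearZr_LR.
Qed.

(** As [J] is an involution, nabla0_X is the average of nabla_X and J nabla_X J. Conjugation by [J]
    flips the sign of the entries mixing [e3] with the plane of [e1], [e2], so these cancel;
    skewness of nabla_X leaves one coefficient. *)
Lemma canonical_connectionE X Y :
  canonical_connection nabla J X Y =
    g (nabla X e1) e2 *: (g Y e1 *: e2 - g Y e2 *: e1).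
Proof.
have skew U V : g (nabla X U) V = - g (nabla X V) U.
  by apply/eqP; rewrite -addr_eq0 (gC (nabla X V)) nabla_metric.
have skew0 U : g (nabla X U) U = 0 by have := skew U U; lra.
rewrite /canonical_connection /cov_endo.
have JJ : J (J Y) = Y.
  by apply: frame_eq; rewrite !product_structureE !gE; ring.
rewrite JJ (bilinear_frame nabla X Y) (bilinear_frame nabla X (J Y)).
by apply: frame_eq; rewrite !product_structureE !gE !skew0
  (skew e2 e1) (skew e3 e1) (skew e3 e2); field.
Qed.

Lemma canonical_curvatureE br X Y Z :
  curvature br (canonical_connection nabla J) X Y Z =
    g (nabla (br X Y) e1) e2 *: (g Z e2 *: e1 - g Z e1 *: e2).
Proof.
rewrite /curvature !canonical_connectionE.
by apply: frame_eq; rewrite !gE; ring.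
Qed.

(** The [e3]-term of the trace vanishes because the curvature takes values in the plane of [e1],
    [e2]. *)
Lemma canonical_ricciE br X Y :
  ricci br g e1 e2 e3 (canonical_connection nabla J) X Y =
    g (nabla (br X e2) e1) e2 * g Y e1 - g (nabla (br X e1) e1) e2 * g Y e2.
Proof. by rewrite /ricci !canonical_curvatureE !gE; ring. Qed.

End PseudoOrthonormalFrame.

(** * Bracket and rotation form of the given Lie algebra *)

Section G1.
Variables (R : realType) (L : vectType R).
Variables (br : {bilinear L -> L -> L}) (g : {symmetric L}) (J : 'End(L)).
Variables (e1 e2 e3 : L) (nabla : {bilinear L -> L -> L}) (alpha beta : R).
Hypothesis br_lie : lie_bracket br.
Hypothesis e_frame : pseudo_orthonormal_basis g e1 e2 e3.
Hypothesis J_frame : [/\ J e1 = e1, J e2 = e2 & J e3 = - e3].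
Hypothesis nabla_lc : levi_civita br g nabla.
Hypothesis br12 : br e1 e2 = alpha *: e1 - beta *: e3.
Hypothesis br13 : br e1 e3 = - (alpha *: e1) - beta *: e2.
Hypothesis br23 : br e2 e3 = beta *: e1 + alpha *: e2 + alpha *: e3.

Let gF := gE e_frame.

Let brxx X : br X X = 0. Proof. by case: br_lie. Qed.

Let brC X Y : br X Y = - br Y X.
Proof.
apply/eqP; rewrite -addr_eq0; apply/eqP.
by have := brxx (X + Y); rewrite linearDl !linearDr !brxx addr0 add0r.
Qed.

Lemma g1_bracketE X Y :
  br X Y = (g X e1 * g Y e2 - g X e2 * g Y e1) *: (alpha *: e1 - beta *: e3)
    + (g X e1 * g Y e3 - g X e3 * g Y e1) *: (alpha *: e1 + beta *: e2)
    + (g X e3 * g Y e2 - g X e2 * g Y e3) *: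
        (beta *: e1 + alpha *: e2 + alpha *: e3).
Proof.
rewrite (bilinear_frame e_frame) (brC X e1) (brC X e2) (brC X e3).
rewrite !(bilinear_frame e_frame br _ X) !brxx (brC e2 e1) (brC e3 e1).
rewrite (brC e3 e2) br12 br13 br23.
apply: (frame_eq e_frame); rewrite !gF; ring.
Qed.

Lemma g1_rotation_form X :
  g (nabla X e1) e2 = - alpha * g X e1 - beta / 2 * g X e3.
Proof.
case: nabla_lc => torsion metric.
rewrite {1}(frame_expansion e_frame X) (linearBl nabla) (linearDl nabla).
rewrite !(linearZl_LR nabla) !gF.
have T U V W : g (nabla U V) W - g (nabla V U) W = g (br U V) W.
  by rewrite -torsion !gF.
have M U V W : g (nabla U V) W = - g (nabla U W) V.
  by apply/eqP; rewrite -addr_eq0 (hermC _ (nabla U W)) expr0 mul1r metric.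
(* Koszul's argument on the frame: these torsion and metric equations form a linear system that
   determines the three values of the rotation form. *)
have := T e1 e2 e1; have := T e1 e2 e2; have := T e1 e2 e3.
have := T e1 e3 e2; have := T e2 e3 e1.
have := M e1 e1 e1; have := M e2 e1 e1; have := M e1 e2 e2; have := M e2 e2 e2.
have := M e1 e2 e1; have := M e2 e2 e1; have := M e3 e2 e1.
have := M e1 e2 e3; have := M e2 e1 e3.
rewrite br12 br13 br23 !gF => *.
have -> : g (nabla e1 e1) e2 = - alpha by lra.
have -> : g (nabla e2 e1) e2 = 0 by lra.
have -> : g (nabla e3 e1) e2 = beta / 2 by lra.
ring.
Qed.

(** * Ricci operator and soliton equation *)

Let nabla0 := canonical_connection nabla J.

Lemma g1_ricci_symE X Y :
  ricci_sym br g e1 e2 e3 nabla0 X Y =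
  - (alpha ^+ 2 + beta ^+ 2 / 2) * (g X e1 * g Y e1 + g X e2 * g Y e2)
  - alpha * beta / 4 * (g X e1 * g Y e3 + g X e3 * g Y e1)
  - alpha ^+ 2 / 2 * (g X e2 * g Y e3 + g X e3 * g Y e2).
Proof.
case: nabla_lc => _ metric.
rewrite /ricci_sym !(canonical_ricciE e_frame metric J_frame).
by rewrite !g1_rotation_form !g1_bracketE !gF; field.
Qed.

Lemma g1_ricci_operatorP (Ric : L -> L) :
  sym_ricci_operator br g e1 e2 e3 nabla0 Ric ->
  [/\ Ric e1 = - (alpha ^+ 2 + beta ^+ 2 / 2) *: e1 - (alpha * beta / 4) *: e3,
      Ric e2 =
        - (alpha ^+ 2 + beta ^+ 2 / 2) *: e2 - (alpha ^+ 2 / 2) *: e3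
    & Ric e3 = (alpha * beta / 4) *: e1 + (alpha ^+ 2 / 2) *: e2].
Proof.
move=> RicP.
by split; apply: (frame_eq e_frame); rewrite -RicP g1_ricci_symE !gF; field.
Qed.

Lemma g1_soliton_constants c :
  alpha != 0 -> second_kind_soliton br g e1 e2 e3 nabla0 c ->
  alpha ^+ 2 / 2 + c = 0 /\ beta = 0.
Proof.
move=> alpha0 [Ric [D [/g1_ricci_operatorP[Ric1 Ric2 Ric3] D_der RicE]]].
have DE X : D X = Ric X - c *: X by rewrite RicE addrC addKr.
have /(_ e1 e2) := D_der; rewrite br12 linearB !linearZ /= !DE Ric1 Ric2 Ric3.
rewrite !g1_bracketE => D12.
have := congr1 (g^~ e1) D12; have := congr1 (g^~ e2) D12.
rewrite /= !gF => E2 E1.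
have beta0 : beta = 0.
  (* [E2] amounts to - alpha^2 beta / 2 = 3 alpha^2 beta / 4. *)
  have : alpha ^+ 2 * beta = 0 by lra.
  by move/eqP; rewrite mulf_eq0 expf_eq0 /= (negbTE alpha0) => /eqP.
split=> //; move: E1; rewrite beta0 => E1.
have : alpha * (alpha ^+ 2 / 2 + c) = 0 by lra.
by move/eqP; rewrite mulf_eq0 (negbTE alpha0) => /eqP.
Qed.

Lemma g1_soliton_exists : beta = 0 ->
  second_kind_soliton br g e1 e2 e3 nabla0 (- (alpha ^+ 2 / 2)).
Proof.
move=> beta0; set h := alpha ^+ 2 / 2.
(* [Ric] takes the values forced by [g1_ricci_operatorP] at [beta = 0], and [D] is [Ric] plus [h]
   times the identity. *)
exists (linfun (frame_map g e1 e2 e3 (- alpha ^+ 2 *: e1)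
  (- alpha ^+ 2 *: e2 - h *: e3) (h *: e2))).
exists (linfun (frame_map g e1 e2 e3 (- h *: e1)
  (- h *: e2 - h *: e3) (h *: e2 + h *: e3))).
split=> [X Y|X Y|X]; rewrite ?lfunE /=.
- rewrite g1_ricci_symE beta0 /frame_map !gF !(hermC g _ Y) !expr0 !mul1r /=.
  by rewrite /h; field.
- rewrite (g1_bracketE (frame_map _ _ _ _ _ _ _ _) Y).
  rewrite (g1_bracketE X (frame_map _ _ _ _ _ _ _ _)) g1_bracketE beta0.
  by apply: (frame_eq e_frame); rewrite /frame_map !gF; ring.
- by apply: (frame_eq e_frame); rewrite /frame_map !gF /h; field.
Qed.

End G1.

Theorem theorem2p7 (R : realType) (L : vectType R)
  (br : {bilinear L -> L -> L}) (g : {symmetric L}) (J : 'End(L))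
  (e1 e2 e3 : L) (nabla : {bilinear L -> L -> L}) (alpha beta c : R)
  (Hbr : lie_bracket br)
  (Hbasis : pseudo_orthonormal_basis g e1 e2 e3)
  (HJ : [/\ J e1 = e1, J e2 = e2 & J e3 = - e3])
  (Hnabla : levi_civita br g nabla)
  (Halpha : alpha != 0)
  (H12 : br e1 e2 = alpha *: e1 - beta *: e3)
  (H13 : br e1 e3 = - (alpha *: e1) - beta *: e2)
  (H23 : br e2 e3 = beta *: e1 + alpha *: e2 + alpha *: e3) :
  let nabla0 := canonical_connection nabla J in
  (second_kind_soliton br g e1 e2 e3 nabla0 c <->
     [/\ alpha ^+ 2 / 2 + c = 0, beta = 0 & alpha != 0]) /\
  ([/\ alpha ^+ 2 / 2 + c = 0, beta = 0 & alpha != 0] ->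
   forall Ric D : 'End(L), soliton_data br g e1 e2 e3 nabla0 c Ric D ->
   [/\ Ric e1 = - alpha ^+ 2 *: e1,
       Ric e2 = - alpha ^+ 2 *: e2 - (alpha ^+ 2 / 2) *: e3
     & Ric e3 = (alpha ^+ 2 / 2) *: e2] /\
   [/\ D e1 = - (alpha ^+ 2 / 2) *: e1,
       D e2 = - (alpha ^+ 2 / 2) *: e2 - (alpha ^+ 2 / 2) *: e3
     & D e3 = (alpha ^+ 2 / 2) *: e2 + (alpha ^+ 2 / 2) *: e3]).
Proof.
have RicP := g1_ricci_operatorP Hbr Hbasis HJ Hnabla H12 H13 H23.
move=> nabla0; split; first split.
- by case/(g1_soliton_constants Hbr Hbasis HJ Hnabla H12 H13 H23 Halpha).
- case=> c_def beta0 _; have -> : c = - (alpha ^+ 2 / 2) by lra.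
  exact: g1_soliton_exists Hbr Hbasis HJ Hnabla H12 H13 H23 beta0.
(* The Ricci form determines [Ric] on the frame, and then [D] is [Ric] minus [c] times the
   identity. *)
case=> c_def beta0 _ Ric D [/RicP[Ric1 Ric2 Ric3] _ RicE].
have DE X : D X = Ric X - c *: X by rewrite RicE addrC addKr.
have cE : c = - (alpha ^+ 2 / 2) by lra.
by split; split; apply: (frame_eq Hbasis);
  rewrite ?DE ?Ric1 ?Ric2 ?Ric3 ?cE beta0 !(gE Hbasis); field.
Qed.
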